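(* Let $\mu,\nu$ be finitely supported and (without loss of generality) $X=\operatorname{spt}\mu$ and $Y=\operatorname{spt}\nu$. Let $C_1,\dots,C_N$ be the components of the optimal support $\operatorname{spt}\pi_*\subset X\times Y$, and fix arbitrary potentials $(f,g)$. Then the family of all potentials is given by $$\left(f+\sum_{i=1}^N\alpha_i\mathbf{1}_{\operatorname{proj}_X(C_i)},\ \ g-\sum_{i=1}^N\alpha_i\mathbf{1}_{\operatorname{proj}_Y(C_i)}\right),\qquad(\alpha_1,\dots,\alpha_N)\in T,$$ where $T\subset\mathbb{R}^N$ is the closed convex polytope $$T=\{(\alpha_1,\dots,\alpha_N)\in\mathbb{R}^N:\ \alpha_i-\alpha_j\le a_{ij}\ \text{ for all } 1\le i,j\le N\}$$ containing the origin, with $$a_{ij}:=\inf_{(x,y)\in[\operatorname{proj}_X(C_i)\times\operatorname{proj}_Y(C_j)]\setminus\operatorname{spt}\pi_*}\big(c(x,y)-f(x)-g(y)\big)\ \ge 0 .$$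
   Context: Setting. $X,Y$ are finite sets carrying probability measures $\mu$ on $X$ and $\nu$ on $Y$ of full support. $\tilde\mu\sim\mu$ and $\tilde\nu\sim\nu$ are probability measures on $X$ and $Y$ (mutually absolutely continuous with $\mu$, $\nu$ respectively), $P:=\tilde\mu\otimes\tilde\nu$, and $c:X\times Y\to\mathbb{R}$ is a cost function. $\Pi(\mu,\nu)$ is the set of couplings of $(\mu,\nu)$; $(f\oplus g)(x,y):=f(x)+g(y)$; $a_+=\max(a,0)$. $\pi_*$ denotes the unique minimizer of $\inf_{\pi\in\Pi(\mu,\nu)}\int c\,d\pi+\frac12\|d\pi/dP\|_{L^2(P)}^2$, and $\operatorname{spt}\pi_*=\{(x,y):\pi_*\{(x,y)\}>0\}$. Potentials: functions $f:X\to\mathbb{R}$, $g:Y\to\mathbb{R}$ are called potentials if $(f\oplus g-c)_+$ is the $P$-density of $\pi_*$ (equivalently, the $P$-density of some coupling in $\Pi(\mu,\nu)$). Components: let $E\subset X\times Y$. Two points $(x,y),(x',y')\in E$ are connected (in $E$) if there exist $k\in\mathbb{N}_0$ and $(x_i,y_i)_{i=1}^k\in E^k$ such that the points $$(x,y),(x_1,y),(x_1,y_1),(x_2,y_1),\dots,(x_k,y_k),(x',y_k),(x',y')$$ all belong to $E$ (for $k=0$ the list is $(x,y),(x',y),(x',y')$). This is an equivalence relation on $E$, and its equivalence classes are called the components of $E$. $\operatorname{proj}_X,\operatorname{proj}_Y$ are the canonical projections of $X\times Y$ onto $X$ and $Y$. Conventions: $\inf\emptyset=+\infty$ (a constraint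 with $a_{ij}=+\infty$ is void); ''polytope'' means a finite intersection of closed half-spaces, possibly unbounded. *)

(* Defs.v *)
From mathcomp Require Import all_boot all_order all_algebra.
From mathcomp Require Import all_classical all_reals all_analysis.

Set Implicit Arguments.
Unset Strict Implicit.
Unset Printing Implicit Defensive.

Import Order.TTheory GRing.Theory Num.Theory.
Import numFieldNormedType.Exports.

Local Open Scope classical_set_scope.
Local Open Scope ring_scope.

(* A measure on a finite set is represented by its mass function, so that
   integrals are finite sums. *)

Section FiniteMeasures.
Context {R : realType}.

Definition is_probability {Z : finType} (m : Z -> R) : Prop :=
  (forall z, 0 <= m z) /\ \sum_z m z = 1.

Definition spt {Z : finType} (m : Z -> R) : set Z := [set z | 0 < m z].

Definition mutually_ac {Z : finType} (m1 m2 : Z -> R) : Prop :=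
  forall z, m1 z = 0 <-> m2 z = 0.

Definition product_measure {X Y : finType} (m : X -> R) (n : Y -> R) :
  X * Y -> R := fun p => m p.1 * n p.2.

Definition integral {Z : finType} (m : Z -> R) (h : Z -> R) : R :=
  \sum_z h z * m z.

Definition L2norm {Z : finType} (m : Z -> R) (h : Z -> R) : R :=
  Num.sqrt (integral m (fun z => h z ^+ 2)).

(* The density dm/dP; points with P z = 0 get the value 0. *)
Definition RNdensity {Z : finType} (m P : Z -> R) : Z -> R :=
  fun z => m z / P z.

Definition is_density {Z : finType} (P h m : Z -> R) : Prop :=
  forall z, m z = h z * P z.

End FiniteMeasures.

Section QuadraticOT.
Context {R : realType} {X Y : finType}.
Implicit Types (mu : X -> R) (nu : Y -> R) (P c p : X * Y -> R).
Implicit Types (f : X -> R) (g : Y -> R).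

Definition coupling mu nu : set (X * Y -> R) :=
  [set p | [/\ forall z, 0 <= p z,
               forall x, \sum_y p (x, y) = mu x &
               forall y, \sum_x p (x, y) = nu y]].

Definition qot_cost P c p : R :=
  integral p c + 2^-1 * L2norm P (RNdensity p P) ^+ 2.

Definition is_minimizer mu nu P c p : Prop :=
  coupling mu nu p /\
  forall q, coupling mu nu q -> qot_cost P c p <= qot_cost P c q.

Definition oplus f g : X * Y -> R := fun z => f z.1 + g z.2.

Definition potentials P c p : set ((X -> R) * (Y -> R)) :=
  [set fg | is_density P (fun z => Num.max (oplus fg.1 fg.2 z - c z) 0) p].

End QuadraticOT.

Section Components.
Context {X Y : eqType}.
Implicit Types (E : set (X * Y)) (z w : X * Y) (s : seq (X * Y)).

(* For z = (x, y), w = (x', y') and s = [:: (x_1, y_1); ...; (x_k, y_k)], the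
   list (x,y), (x_1,y), (x_1,y_1), (x_2,y_1), ..., (x_k,y_k), (x',y_k), (x',y').
   *)
Fixpoint zigzag z s w : seq (X * Y) :=
  if s is r :: s' then z :: (r.1, z.2) :: zigzag r s' w
  else [:: z; (w.1, z.2); w].

Definition connected_in E z w : Prop :=
  exists s, [set` zigzag z s w] `<=` E.

Definition components E : set (set (X * Y)) :=
  [set [set w | E w /\ connected_in E z w] | z in E].

End Components.

Section PotentialPolytope.
Context {R : realType} {X Y : finType} {N : nat}.
Implicit Types (C : 'I_N -> set (X * Y)) (S : set (X * Y)) (c : X * Y -> R).
Implicit Types (f : X -> R) (g : Y -> R) (alpha : 'rV[R]_N).

(* ereal_inf set0 = +oo, so the constraint of an empty index set is void. *)
Definition gap S C c f g (i j : 'I_N) : \bar R :=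
  ereal_inf [set (c z - f z.1 - g z.2)%:E |
              z in ((fst @` C i) `*` (snd @` C j)) `\` S].

Definition shift_set S C c f g : set 'rV[R]_N :=
  [set alpha | forall i j,
    ((alpha ord0 i - alpha ord0 j)%:E <= gap S C c f g i j)%E].

Definition shifted C f g alpha : (X -> R) * (Y -> R) :=
  (fun x => f x + \sum_(i < N) alpha ord0 i * \1_(fst @` C i) x,
   fun y => g y - \sum_(i < N) alpha ord0 i * \1_(snd @` C i) y).

End PotentialPolytope.

Section Polytopes.
Context {R : realType} {N : nat}.

Definition closed_half_space (H : set 'rV[R]_N) : Prop :=
  exists (u : 'rV[R]_N) (b : R),
    u != 0 /\ H = [set v | \sum_(i < N) u ord0 i * v ord0 i <= b].

(* Possibly unbounded. *)
Definition polytope (T : set 'rV[R]_N) : Prop :=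
  exists (m : nat) (H : 'I_m -> set 'rV[R]_N),
    (forall k, closed_half_space (H k)) /\ T = \bigcap_k H k.

End Polytopes.

(* Main.v *)
Require Import Defs.
From mathcomp Require Import all_boot all_order all_algebra.
From mathcomp Require Import all_classical all_reals all_analysis.
Import Order.TTheory GRing.Theory Num.Theory.
Import numFieldNormedType.Exports.
Local Open Scope classical_set_scope.
Local Open Scope ring_scope.

(** Since [P] charges every point, a pair [(f', g')] is a potential exactly when
    its sum is prescribed on the support of the optimal coupling (equal to
    [c + d pi / d P] there) and is at most [c] off the support
    ([potentialsE]).

    Hence the sums of two potentials [(f, g)] and [(f', g')] agree on the
    support, so that [f' - f] at [x] equals [g - g'] at [y] for each support
    point [(x, y)].  Moving along one coordinate inside the support thus
    changes neither difference, and both take a common constant value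
    [alpha_i] on the component [C_i].  Because the marginals have full support,
    every [x] and every [y] lies in the projection of some component, and of
    only one: two support points that share a coordinate are connected
    ([component_eq]).  So [(f', g')] is the shift of [(f, g)] by [alpha].

    Conversely a shift by [alpha] changes the sum at [(x, y)] by
    [alpha_i - alpha_j], where [x] projects from [C_i] and [y] from [C_j]
    ([oplus_shifted]).  On the support [i = j] and nothing changes; off the
    support, the requirement that the sum stay below [c] reads
    [alpha_i - alpha_j <= c - f - g], and its conjunction over all such points
    is [alpha_i - alpha_j <= a_ij].  These are finitely many linear
    inequalities, whose bounds are nonnegative because [(f, g)] itself is below
    [c] off the support. *)

Local Open Scope convex_scope.

(** * Components of a set of pairs *)

Section Connectedness.
Context {X Y : eqType}.
Implicit Types (E : set (X * Y)) (z w : X * Y) (s : seq (X * Y)).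

(** A zigzag only moves along one coordinate at a time, so connectedness is
    contained in any transitive relation that relates points sharing a
    coordinate.  Applied below to the symmetry of connectedness, and to the
    invariance of a potential difference. *)
Lemma connected_ind E (Q : X * Y -> X * Y -> Prop) :
  (forall z w v, Q z w -> Q w v -> Q z v) ->
  (forall z w, E z -> E w -> z.1 = w.1 \/ z.2 = w.2 -> Q z w) ->
  forall z w, connected_in E z w -> Q z w.
Proof.
move=> Qtr Qstep z w [s]; elim: s z => [|r s IHs] z /= sE.
- have Ez : E z by apply: sE; rewrite /= !inE eqxx.
  have Em : E (w.1, z.2) by apply: sE; rewrite /= !inE eqxx orbT.
  have Ew : E w by apply: sE; rewrite /= !inE eqxx !orbT.
  by apply: (Qtr _ (w.1, z.2)); apply: Qstep => //; [right | left].
- have Ez : E z by apply: sE; rewrite /= !inE eqxx.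
  have Em : E (r.1, z.2) by apply: sE; rewrite /= !inE eqxx orbT.
  have Er : E r.
    by apply: sE; case: s {IHs} => [|t s] /=; rewrite !inE eqxx !orbT.
  apply: (Qtr _ r).
    by apply: (Qtr _ (r.1, z.2)); apply: Qstep => //; [right | left].
  by apply: IHs => v v_s; apply: sE; rewrite /= !inE v_s !orbT.
Qed.

Lemma connected_step E z w :
  E z -> E w -> z.1 = w.1 \/ z.2 = w.2 -> connected_in E z w.
Proof.
move=> Ez Ew zw; exists [::] => v /=; rewrite !inE => /or3P[] /eqP -> //.
by case: zw => [<-|->]; rewrite -surjective_pairing.
Qed.

Lemma connected_trans E z w v :
  connected_in E z w -> connected_in E w v -> connected_in E z v.
Proof.
move=> [s sE] [t tE]; exists (s ++ w :: t).
elim: s z sE => [|r s IHs] z /= sE u /=; rewrite !inE.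
- by case/or3P => [/eqP->|/eqP->|/tE //]; apply: sE; rewrite /= !inE eqxx ?orbT.
- case/or3P => [/eqP->|/eqP->|]; try by apply: sE; rewrite /= !inE eqxx ?orbT.
  by apply: IHs => a a_s; apply: sE; rewrite /= !inE a_s !orbT.
Qed.

Lemma connected_sym E z w : connected_in E z w -> connected_in E w z.
Proof.
apply: (connected_ind E (fun a b => connected_in E b a)) =>
  [a b d ba db | a b Ea Eb ab]; first exact: connected_trans db ba.
by apply: connected_step => //; case: ab => ->; [left | right].
Qed.

(** Two classes of an equivalence relation that have related elements coincide;
    this is what makes the projections of distinct components disjoint. *)
Lemma component_eq E A B z w : components E A -> components E B ->
  A z -> B w -> z.1 = w.1 \/ z.2 = w.2 -> A = B.
Proof.
move=> [a Ea <-] [b Eb <-] [Ez az] [Ew bw] zw.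
have ab : connected_in E a b.
  apply: connected_trans az _.
  apply: connected_trans _ (connected_sym _ _ _ bw).
  exact: connected_step.
apply/seteqP; split=> v [Ev ?]; split=> //.
- exact: connected_trans (connected_sym _ _ _ ab) _.
- exact: connected_trans ab _.
Qed.

End Connectedness.

Lemma sum_indic {R : realType} {T : Type} {N : nat} (A : 'I_N -> set T)
    (alpha : 'I_N -> R) (x : T) (i : 'I_N) :
  A i x -> (forall j, A j x -> j = i) ->
  \sum_(j < N) alpha j * \1_(A j) x = alpha i.
Proof.
move=> Aix Auniq; rewrite (bigD1 i) //= big1 => [|j ji].
  by rewrite addr0 indicE mem_set // mulr1.
rewrite indicE memNset ?mulr0 // => /Auniq jE; by rewrite jE eqxx in ji.
Qed.

(** * Potentials as equations on the support and inequalities off it *)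

Section Potentials.
Context {R : realType} {X Y : finType}.

(** Dividing by [P], the positive part of [f + g - c] is [p / P] everywhere.  A
    positive value of a positive part determines its argument, whereas the value
    zero only says that the argument is nonpositive. *)
Lemma potentialsE (P c p : X * Y -> R) (f : X -> R) (g : Y -> R) :
  (forall z, 0 < P z) -> (forall z, 0 <= p z) ->
  potentials P c p (f, g) <->
  (forall z, spt p z -> oplus f g z = c z + p z / P z) /\
  (forall z, ~ spt p z -> oplus f g z <= c z).
Proof.
move=> P_gt0 p_ge0; have p0 z : ~ spt p z -> p z = 0.
  by move=> /negP; rewrite -leNgt => pz; apply/eqP; rewrite eq_le pz p_ge0.
split=> [dens | [on off] z].
- have densE z : Num.max (oplus f g z - c z) 0 = p z / P z.
    by rewrite (dens z) mulfK // gt_eqF.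
  split=> z pz; have := densE z;
    case: (leP (oplus f g z - c z) 0) => // fgc.
  + by move=> /esym/eqP; rewrite gt_eqF // divr_gt0.
  + by move=> <-; rewrite addrC subrK.
  + by rewrite -subr_le0.
  + by rewrite (p0 z pz) mul0r => fgc0; rewrite fgc0 ltxx in fgc.
- have [pz|pz] := pselect (spt p z) => /=.
  + rewrite (on z pz) addrC addKr max_l ?divfK ?gt_eqF //.
    by rewrite divr_ge0 // ltW.
  + by rewrite max_r ?mul0r ?p0 // subr_le0 off.
Qed.

Lemma le_gapP {N : nat} (S : set (X * Y)) (C : 'I_N -> set (X * Y))
    (c : X * Y -> R) (f : X -> R) (g : Y -> R) (i j : 'I_N) (r : R) :
  (r%:E <= gap S C c f g i j)%E <->
  forall z, (fst @` C i) z.1 -> (snd @` C j) z.2 -> ~ S z ->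
    r <= c z - f z.1 - g z.2.
Proof.
split=> [rgap z zi zj zS | rle].
- rewrite -lee_fin; apply: le_trans rgap _; apply: ereal_inf_lbound.
  by exists z.
- by apply: le_ereal_inf_tmp => _ [z [[zi zj] zS] <-]; rewrite lee_fin rle.
Qed.

End Potentials.

(** * Polytopes *)

Section Polytopes.
Context {R : realType} {N : nat}.
Implicit Types (T : set 'rV[R]_N) (a : 'I_N -> 'I_N -> \bar R).

Lemma closed_polytope T : polytope T -> closed T.
Proof.
move=> [m [H [Hhalf ->]]]; apply: closed_bigI => k _.
have [u [b [_ ->]]] := Hhalf k.
pose l (v : 'rV[R]_N) := \sum_(i < N) u ord0 i * v ord0 i.
suff l_cont : continuous l.
  by apply: (@preimage_closed _ _ l [set t | t <= b]) => // *; apply: l_cont.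
have -> : l = \sum_(i < N) (fun v : 'rV[R]_N => u ord0 i * v ord0 i).
  by apply/funext => v; rewrite fct_sumE.
elim/big_ind: _ => [v|h1 h2 h1_cont h2_cont v|i _ v].
- exact: (@cst_continuous _ _ (0 : R)).
- exact: cvgD (h1_cont v) (h2_cont v).
- exact: (@cvgM _ _ _ _ (fun=> u ord0 i) (fun v : 'rV[R]_N => v ord0 i) _ _
            (cvg_cst _) (@coord_continuous R 1 N ord0 i v)).
Qed.

Lemma convex_polytope T :
  polytope T -> convex_set (T : set (convex_lmodType 'rV[R]_N)).
Proof.
move=> [m [H [Hhalf ->]]] v w t /set_mem vT /set_mem wT; apply/mem_set => k _.
have := vT k I; have := wT k I; have [u [b [_ ->]]] := Hhalf k => /= wb vb.
have t_ge0 : 0 <= t%:num by [].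
have onem_t_ge0 : 0 <= 1 - t%:num by rewrite subr_ge0.
have -> : \sum_(i < N) u ord0 i * (v <| t |> w : 'rV[R]_N) ord0 i =
    t%:num * (\sum_(i < N) u ord0 i * v ord0 i) +
    (1 - t%:num) * (\sum_(i < N) u ord0 i * w ord0 i).
  rewrite !mulr_sumr -big_split /=; apply: eq_bigr => i _.
  by rewrite !mxE mulrDr; congr (_ + _); rewrite mulrCA.
have -> : b = t%:num * b + (1 - t%:num) * b.
  by rewrite -mulrDl addrC subrK mul1r.
by apply: lerD; apply: ler_wpM2l.
Qed.

(** A closed half-space needs a nonzero normal vector and a finite bound.  The
    constraints that fail this are the diagonal ones and the ones with infinite
    bound, and they hold everywhere since [a] is nonnegative, so that the
    half-spaces can be indexed by the remaining pairs [(i, j)]. *)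
Lemma polytope_difference_constraints a : (forall i j, (0 <= a i j)%E) ->
  polytope [set v : 'rV[R]_N |
    forall i j, ((v ord0 i - v ord0 j)%:E <= a i j)%E].
Proof.
move=> a_ge0.
pose K := [pred p : 'I_N * 'I_N | (p.1 != p.2) && (a p.1 p.2 < +oo)%E].
(* The normal vector of the constraint on [v_i - v_j]. *)
pose u (p : 'I_N * 'I_N) : 'rV[R]_N := delta_mx ord0 p.1 - delta_mx ord0 p.2.
have uE p (v : 'rV[R]_N) :
    \sum_(i < N) u p ord0 i * v ord0 i = v ord0 p.1 - v ord0 p.2.
  under eq_bigr => i _ do rewrite !mxE eqxx /= mulrBl.
  rewrite sumrB; congr (_ - _).
  - rewrite (bigD1 p.1) //= eqxx mul1r big1 ?addr0 // => i ip.
    by rewrite (negbTE ip) mul0r.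
  - rewrite (bigD1 p.2) //= eqxx mul1r big1 ?addr0 // => i ip.
    by rewrite (negbTE ip) mul0r.
have aK p : p \in K -> (fine (a p.1 p.2))%:E = a p.1 p.2.
  case/andP=> _ a_fin; rewrite fineK // ge0_fin_numE //.
exists #|K|, (fun k => [set v | \sum_(i < N) u (enum_val k) ord0 i * v ord0 i
                                <= fine (a (enum_val k).1 (enum_val k).2)]).
split=> [k|].
- exists (u (enum_val k)), (fine (a (enum_val k).1 (enum_val k).2)); split=> //.
  have /andP[ne _] := enum_valP k.
  apply/eqP => /matrixP /(_ ord0 (enum_val k).1).
  by rewrite !mxE !eqxx (negbTE ne) subr0 => /eqP; rewrite oner_eq0.
- apply/seteqP; split=> v /= vT.
  + by move=> k _ /=; rewrite uE -lee_fin aK ?enum_valP.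
  + move=> i j; have [<-|ij] := eqVneq i j; first by rewrite subrr.
    have [aij|] := ltP (a i j) +oo%E; last first.
      by rewrite leye_eq => /eqP ->; rewrite leey.
    have ijK : (i, j) \in K by rewrite inE /= ij.
    have := vT (enum_rank_in ijK (i, j)) I.
    by rewrite /= uE enum_rankK_in // -lee_fin aK.
Qed.

End Polytopes.

(** * Shifting potentials along components *)

Section PotentialsOfComponents.
Context {R : realType} {X Y : finType} {N : nat}.
Context (P c p : X * Y -> R) (C : 'I_N -> set (X * Y)).
Context (f : X -> R) (g : Y -> R).
Hypotheses (P_gt0 : forall z, 0 < P z) (p_ge0 : forall z, 0 <= p z).
Hypotheses (proj_fst : forall x, exists y, spt p (x, y))
           (proj_snd : forall y, exists x, spt p (x, y)).
Hypothesis C_enum : set_bij [set: 'I_N] (components (spt p)) C.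
Hypothesis fg_pot : potentials P c p (f, g).

Let compC i : components (spt p) (C i).
Proof. by case: C_enum => + _ _; apply. Qed.

(** The single property behind the disjointness of projections: an index is
    determined by either coordinate of a point of its component. *)
Let C_inj i j z w : C i z -> C j w -> z.1 = w.1 \/ z.2 = w.2 -> i = j.
Proof.
move=> zi wj zw; case: C_enum => _ Cinj _; apply: Cinj; rewrite ?inE //.
exact: component_eq zi wj zw.
Qed.

Let C_cover z : spt p z -> exists i, C i z.
Proof.
move=> pz; case: C_enum => _ _.
move=> /(_ [set w | spt p w /\ connected_in (spt p) z w]).
case=> [|i _ Ci]; first by exists z.
exists i; rewrite Ci; split=> //.
by apply: connected_step => //; left.
Qed.

(** The projections of the components are pairwise disjoint, so only one term of
    the sum defining the shift survives at a given point. *)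
Lemma shifted_fst alpha i x : (fst @` C i) x ->
  (shifted C f g alpha).1 x = f x + alpha ord0 i.
Proof.
move=> xi; rewrite /= (@sum_indic _ _ _ (fun j => fst @` C j) _ _ i) // => j.
case=> w wj wx; case: xi => z zi zx; apply: C_inj wj zi _.
by left; rewrite wx zx.
Qed.

Lemma shifted_snd alpha j y : (snd @` C j) y ->
  (shifted C f g alpha).2 y = g y - alpha ord0 j.
Proof.
move=> yj; rewrite /= (@sum_indic _ _ _ (fun i => snd @` C i) _ _ j) // => i.
case=> w wi wy; case: yj => z zj zy; apply: C_inj wi zj _.
by right; rewrite wy zy.
Qed.

Lemma fst_cover x : exists i, (fst @` C i) x.
Proof.
by have [y /C_cover[i xyi]] := proj_fst x; exists i; exists (x, y).
Qed.

Lemma snd_cover y : exists j, (snd @` C j) y.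
Proof.
by have [x /C_cover[j xyj]] := proj_snd y; exists j; exists (x, y).
Qed.

Lemma oplus_shifted alpha i j z : (fst @` C i) z.1 -> (snd @` C j) z.2 ->
  oplus (shifted C f g alpha).1 (shifted C f g alpha).2 z =
  oplus f g z + (alpha ord0 i - alpha ord0 j).
Proof.
move=> zi zj.
by rewrite /oplus (shifted_fst _ _ _ zi) (shifted_snd _ _ _ zj) addrACA.
Qed.

Lemma shifted_potentials alpha : shift_set (spt p) C c f g alpha ->
  potentials P c p (shifted C f g alpha).
Proof.
have [fg_on fg_off] := (potentialsE P c p f g P_gt0 p_ge0).1 fg_pot.
move=> alphaT; rewrite [shifted _ _ _ _]surjective_pairing.
apply/potentialsE => //; split=> z pz.
- have [i zi] := C_cover z pz.
  by rewrite (oplus_shifted alpha i i) ?subrr ?addr0 ?fg_on //; exists z.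
- have [i zi] := fst_cover z.1; have [j zj] := snd_cover z.2.
  have /le_gapP /(_ z zi zj pz) := alphaT i j.
  by rewrite (oplus_shifted alpha i j) // -addrA -opprD lerBrDr addrC.
Qed.

(** The shift vector is read off at one chosen point of each component, the
    choice being immaterial since [f' - f] is constant along zigzags. *)
Lemma potentials_shifted f' g' : potentials P c p (f', g') ->
  exists2 alpha, shift_set (spt p) C c f g alpha &
                 shifted C f g alpha = (f', g').
Proof.
have [fg_on fg_off] := (potentialsE P c p f g P_gt0 p_ge0).1 fg_pot.
move=> /(potentialsE P c p f' g' P_gt0 p_ge0)[fg'_on fg'_off].
have diff z : spt p z -> f' z.1 - f z.1 = g z.2 - g' z.2.
  move=> pz; have sumE : f' z.1 + g' z.2 = f z.1 + g z.2.
    exact: etrans (fg'_on z pz) (esym (fg_on z pz)).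
  by rewrite -[f' z.1](addrK (g' z.2)) sumE addrAC [f _ + _]addrC addrK.
have [z0 z0C] : {z0 : 'I_N -> X * Y & forall i, C i (z0 i)}.
  apply: (@choice _ _ (fun i z => C i z)) => i; have [z pz <-] := compC i.
  by exists z; split=> //; apply: connected_step => //; left.
pose alpha : 'rV[R]_N := \row_i (f' (z0 i).1 - f (z0 i).1).
have alphaE i w : C i w -> f' w.1 - f w.1 = alpha ord0 i.
  rewrite mxE => wi; have := z0C i; have [z pz Ci] := compC i.
  move: wi; rewrite -Ci => -[pw zw] [pz0 zz0].
  have : connected_in (spt p) w (z0 i).
    exact: connected_trans (connected_sym _ _ _ zw) zz0.
  apply: (connected_ind (spt p) (fun a b => f' a.1 - f a.1 = f' b.1 - f b.1)).
    by move=> ? ? ? -> .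
  by move=> a b pa pb [->|ab] //; rewrite !diff // ab.
have compC_spt i w : C i w -> spt p w.
  by have [z _ <-] := compC i; case.
have alpha1 i x : (fst @` C i) x -> f' x = f x + alpha ord0 i.
  by case=> w wi <-; rewrite -(alphaE i w wi) addrC subrK.
have alpha2 i y : (snd @` C i) y -> g' y = g y - alpha ord0 i.
  case=> w wi <-; rewrite -(alphaE i w wi) diff ?subKr //.
  exact: compC_spt wi.
exists alpha.
- move=> i j; apply/le_gapP => z zi zj pz.
  have := fg'_off z pz; rewrite /oplus (alpha1 i) // (alpha2 j) //.
  by rewrite addrACA addrC -lerBrDr opprD addrA.
- congr pair; apply/funext.
  + by move=> x; have [i xi] := fst_cover x; rewrite (alpha1 i) // -shifted_fst.
  + by move=> y; have [j yj] := snd_cover y; rewrite (alpha2 j) // -shifted_snd.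
Qed.

Lemma gap_ge0 i j : (0 <= gap (spt p) C c f g i j)%E.
Proof.
apply/le_gapP => z _ _ pz.
have [_ fg_off] := (potentialsE P c p f g P_gt0 p_ge0).1 fg_pot.
by rewrite -addrA -opprD subr_ge0 fg_off.
Qed.

End PotentialsOfComponents.

Theorem theorem3p5 (R : realType) (X Y : finType)
  (mu mut : X -> R) (nu nut : Y -> R) (c : X * Y -> R)
  (pistar : X * Y -> R) (N : nat) (C : 'I_N -> set (X * Y))
  (f : X -> R) (g : Y -> R)
  (mu_prob : is_probability mu) (nu_prob : is_probability nu)
  (mu_full : spt mu = [set: X]) (nu_full : spt nu = [set: Y])
  (mut_prob : is_probability mut) (nut_prob : is_probability nut)
  (mut_ac : mutually_ac mut mu) (nut_ac : mutually_ac nut nu)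
  (pistar_opt : is_minimizer mu nu (product_measure mut nut) c pistar)
  (C_enum : set_bij [set: 'I_N] (components (spt pistar)) C)
  (fg_pot : potentials (product_measure mut nut) c pistar (f, g)) :
  let a := gap (spt pistar) C c f g in
  let T := shift_set (spt pistar) C c f g in
  potentials (product_measure mut nut) c pistar
    = [set shifted C f g alpha | alpha in T] /\
  [/\ polytope T, closed T, convex_set (T : set (convex_lmodType 'rV[R]_N)),
      T 0 & forall i j, (0 <= a i j)%E].
Proof.
move=> a T.
have gt0_of (Z : finType) (m m' : Z -> R) : is_probability m' ->
    mutually_ac m' m -> spt m = [set: Z] -> forall z, 0 < m' z.
  move=> [m'_ge0 _] ac m_full z; rewrite lt_neqAle m'_ge0 andbT eq_sym.
  apply/eqP => /ac mz; have : spt m z by rewrite m_full.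
  by rewrite /spt /= mz ltxx.
have P_gt0 z : 0 < product_measure mut nut z.
  by rewrite mulr_gt0 ?(gt0_of _ mu) ?(gt0_of _ nu).
have [[p_ge0 p_mu p_nu] _] := pistar_opt.
have pos_sum (Z : finType) (h : Z -> R) :
    (forall z, 0 <= h z) -> 0 < \sum_z h z -> exists z, 0 < h z.
  move=> h_ge0 /lt0r_neq0; rewrite psumr_neq0 // => /hasP[z _ hz].
  by exists z.
have proj_fst x : exists y, spt pistar (x, y).
  apply: (pos_sum _ (fun y => pistar (x, y))) => //.
  by rewrite p_mu; have : spt mu x by rewrite mu_full.
have proj_snd y : exists x, spt pistar (x, y).
  apply: (pos_sum _ (fun x => pistar (x, y))) => //.
  by rewrite p_nu; have : spt nu y by rewrite nu_full.
have a_ge0 i j : (0 <= a i j)%E by apply: gap_ge0 fg_pot i j.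
have T_poly : polytope T by apply: polytope_difference_constraints.
split.
- apply/seteqP; split=> [[f' g'] | _ [alpha alphaT <-]].
  + exact: potentials_shifted fg_pot _ _.
  + exact: shifted_potentials fg_pot _ _.
- split=> //; [exact: closed_polytope | exact: convex_polytope | ].
  by move=> i j; rewrite !mxE subrr; apply: a_ge0.
Qed.
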